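(* Let $x\in X$ and set $y(x)=\lim_{n\to\infty}P_F(nv+T^nx)$ (this limit exists in norm and belongs to $F$). Then, as $n\to\infty$, $$P_UT^nx\rightharpoonup P_Uy(x)\in\operatorname{argmin}\big(\iota_U+g(\cdot-v)\big),$$ $$T^{n+1}x-T^nx+P_UT^nx=\operatorname{Prox}_g(R_UT^nx)\rightharpoonup -v+P_Uy(x),$$ and $$g\big(\operatorname{Prox}_g(R_UT^nx)\big)\to\min\big(\iota_U+g(\cdot-v)\big),$$ where $\rightharpoonup$ denotes weak convergence.
   Context: $X$ is a real Hilbert space with inner product $\langle\cdot,\cdot\rangle$ and norm $\|\cdot\|$; $U$ is a closed linear subspace of $X$; $g\colon X\to\,]-\infty,+\infty]$ is convex, lower semicontinuous and proper, with $\operatorname{dom}g=\{x: g(x)<+\infty\}$, subdifferential $\partial g$ and Fenchel conjugate $g^*$. $\iota_U$ is the indicator function of $U$ ($0$ on $U$, $+\infty$ off $U$). $N_U$ is the normal cone operator: $N_U(x)=U^\perp$ if $x\in U$, and $\varnothing$ otherwise. For a nonempty closed convex set $C$, $P_C$ is the projector onto $C$. $R_U=2P_U-\operatorname{Id}=P_U-P_{U^\perp}$. $\operatorname{Prox}_g(x)$ is the unique minimizer of $z\mapsto g(z)+\tfrac12\|x-z\|^2$. The Douglas--Rachford operator is $T=\operatorname{Id}-P_U+\operatorname{Prox}_gR_U$, with iterates $T^n$ ($T^0=\operatorname{Id}$). The minimal displacement vector is $v=P_{\overline{\operatorname{ran}}(\operatorname{Id}-T)}(0)$ (the set $\overline{\operatorname{ran}}(\operatorname{Id}-T)$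 is nonempty, closed and convex). The set of normal solutions is $Z=\{x\in X: v\in N_U(x)+\partial g(x-v)\}$. The set $F=\{x\in X: x=T(x+v)\}$ is convex, closed, and (when $Z\ne\varnothing$) nonempty. Standing assumptions: (a) $Z\neq\varnothing$ (then $Z$ is closed and convex); (b) $P_Z$ is weak-to-weak continuous (automatic if $X$ is finite-dimensional); (c) $0\in U^\perp+\operatorname{dom}g^*$; (d) $v=P_{\overline{U-\operatorname{dom}g}}(0)$ (automatic from (c) if $X$ is finite-dimensional). *)

(* Defs.v *)
From mathcomp Require Import all_boot all_order all_algebra.
From mathcomp Require Import sesquilinear.
From mathcomp Require Import all_classical all_reals all_analysis.
Set Implicit Arguments.
Unset Strict Implicit.
Unset Printing Implicit Defensive.
Import Order.TTheory GRing.Theory Num.Theory.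
Import numFieldNormedType.Exports.
Local Open Scope classical_set_scope.
Local Open Scope ring_scope.

(* A real Hilbert space is a [completeNormedModType] over a [realType] together
   with a symmetric, bilinear, positive definite form [ip : {dot X for idfun}]
   that induces the norm of [X]. *)
Definition induces_norm (R : realType) (X : normedModType R)
    (ip : {dot X for idfun}) :=
  forall x : X, `|x| ^+ 2 = ip x x.

Definition set_add (V : zmodType) (A B : set V) : set V :=
  [set a + b | a in A & b in B].

Definition set_sub (V : zmodType) (A B : set V) : set V :=
  [set a - b | a in A & b in B].

Section ExtendedRealFunctions.
Context {R : realType} {X : normedModType R}.
Implicit Types (f g : X -> \bar R) (U C : set X).
Local Open Scope ereal_scope.

Definition edom f : set X := [set x | f x < +oo].

Definition eproper f := (forall x, -oo < f x) /\ edom f !=set0.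

(* For a function that never takes the value -oo the right-hand side is never
   of the form [+oo - oo]. *)
Definition econvex f :=
  forall (x y : X) (t : R), (0 < t)%R -> (t < 1)%R ->
    f (t *: x + (1 - t) *: y)%R <= t%:E * f x + (1 - t)%:E * f y.

Definition argmin f : set X := [set x | forall z, f x <= f z].

Definition eindicator U (x : X) : \bar R := if x \in U then 0 else +oo.

(* The choice [xget] is the unique minimizer whenever [g] is convex, lower
   semicontinuous and proper and [X] is a Hilbert space. *)
Definition prox g (x : X) : X :=
  xget 0%R (argmin (fun z => g z + (2^-1 * `|x - z| ^+ 2)%:E)).

(* The choice [xget] is the unique nearest point whenever [C] is nonempty,
   closed and convex and [X] is a Hilbert space. *)
Definition projector C (x : X) : X :=
  xget 0%R [set p | C p /\ forall q, C q -> (`|x - p| <= `|x - q|)%R].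

End ExtendedRealFunctions.

Section HilbertNotions.
Context {R : realType} {X : normedModType R}.
Variable ip : {dot X for idfun}.
Implicit Types (g : X -> \bar R) (U : set X).

Definition orth U : set X := [set u | forall x, U x -> ip x u = 0].

(* This is the normal cone of a linear subspace only. *)
Definition normal_cone U (x : X) : set X := if x \in U then orth U else set0.

Definition subdiff g (x : X) : set X :=
  [set u | forall z, (g x + (ip (z - x) u)%:E <= g z)%E].

Definition conjugate g (u : X) : \bar R :=
  ereal_sup (range (fun x => (ip x u)%:E - g x)%E).

(* The coarsest topology on [X] making every [fun x => ip x z] continuous. *)
Definition weak_top : topologicalType :=
  initial_topology (fun x : X => (fun z => ip x z) : {ptws X -> R}).

Definition weakly_cvg (u : nat -> X) (l : X) :=
  (u : nat -> weak_top) @ \oo --> (l : weak_top).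

Definition weak_to_weak_continuous (f : X -> X) :=
  continuous (f : weak_top -> weak_top).

End HilbertNotions.

Section DouglasRachford.
Context {R : realType} {X : normedModType R}.
Implicit Types (g : X -> \bar R) (U : set X).

Definition reflector U (x : X) : X := 2 *: projector U x - x.

Definition DR U g (x : X) : X := x - projector U x + prox g (reflector U x).

Definition min_displacement (T : X -> X) : X :=
  projector (closure (range (fun x => x - T x))) 0.

Definition normal_solutions (ip : {dot X for idfun}) U g (v : X) : set X :=
  [set x | set_add (normal_cone ip U x) (subdiff ip g (x - v)) v].

Definition shifted_fix (T : X -> X) (v : X) : set X := [set x | x = T (x + v)].

End DouglasRachford.

(* Main.v *)
Require Import Defs.
From mathcomp Require Import all_boot all_order all_algebra.
From mathcomp Require Import sesquilinear.
From mathcomp Require Import all_classical all_reals all_analysis.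
From mathcomp Require Import ring lra.
Set Implicit Arguments.
Unset Strict Implicit.
Unset Printing Implicit Defensive.
Import Order.TTheory GRing.Theory Num.Theory.
Import numFieldNormedType.Exports.
Local Open Scope classical_set_scope.
Local Open Scope ring_scope.

(** Write t_n = T^n x, x_n = n v + t_n, p_n = P_U t_n, q_n = Prox_g (R_U t_n)
    and d_n = t_n - T t_n = p_n - q_n.

    Since v is the nearest point to 0 in the closure of U - dom g, it is
    orthogonal to U and satisfies [ip v v <= ip (p - w) v] for p in U and w in
    dom g.  In particular p_n = P_U x_n, and F is stable under translation by
    -v, whence T^n f = f - n v for f in F ([DR_orbit]).  As T is firmly
    nonexpansive ([DR_firm]), comparing the orbit of x with the one of f gives
    |x_(n+1) - f|^2 + |d_n - v|^2 <= |x_n - f|^2 ([fejer]).  Three facts follow: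
    (x_n) is bounded, d_n converges to v, and u_n = P_F x_n is a Cauchy sequence,
    which yields y.

    The values g(q_n) are squeezed between two bounds that differ from
    m = min (iota_U + g(. - v)) by a multiple of |d_n - v|.  The lower one is the
    subgradient inequality at z - v for a normal solution z, whose subgradient is
    orthogonal to U; the upper one is the subgradient inequality that
    characterizes q_n as a proximal point, in which the term n (ip d_n v - ip v v)
    has the right sign ([prox_value_ge], [prox_value_le]).  Hence g(q_n) tends to
    m.  By weak lower semicontinuity of g, a weak cluster point c of (p_n) is in U
    with g(c - v) <= m, and such a point is a normal solution, because the
    subgradient of one normal solution serves all of them
    ([min_normal_solution]).  So every weak cluster point of (p_n) is in Z.

    The same exchange of subgradients shows that F is invariant when its
    U-component is replaced by any point of Z ([shifted_fix_move]), so the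
    projector onto F acts on U-components as the projector onto Z:
    P_Z p_n = P_U u_n, which converges in norm to P_U y.  Weak continuity of P_Z
    at a cluster point c of (p_n) then gives c = P_Z c = P_U y.  The bounded
    sequence (p_n) has a single weak cluster point and therefore converges
    weakly; q_n = p_n - d_n follows.

    Weak compactness is used through ultrafilters on nat: along an ultrafilter,
    every real sequence [ip p_n w] has a limit, and the Riesz theorem represents
    the limit functional. *)

(** * The inner product *)

Section InnerProduct.
Context (R : realType) (X : normedModType R) (ip : {dot X for idfun}).

Lemma ipC x y : ip x y = ip y x.
Proof. by rewrite hermC expr0 mul1r. Qed.

Lemma ipDl x y z : ip (x + y) z = ip x z + ip y z.
Proof. exact: linearDl. Qed.

Lemma ipNl x z : ip (- x) z = - ip x z.
Proof. exact: linearNl. Qed.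

Lemma ipZl a x z : ip (a *: x) z = a * ip x z.
Proof. exact: linearZl_LR. Qed.

Lemma ip0l z : ip 0 z = 0.
Proof. exact: linear0l. Qed.

Lemma ipDr x y z : ip z (x + y) = ip z x + ip z y.
Proof. by rewrite ![ip z _]ipC ipDl. Qed.

Lemma ipNr x z : ip z (- x) = - ip z x.
Proof. by rewrite ![ip z _]ipC ipNl. Qed.

Lemma ipZr a x z : ip z (a *: x) = a * ip z x.
Proof. by rewrite ![ip z _]ipC ipZl. Qed.

Lemma ip0r z : ip z 0 = 0.
Proof. by rewrite ipC ip0l. Qed.

Definition ipE := (ipDl, ipNl, ipZl, ip0l, ipDr, ipNr, ipZr, ip0r).

Hypothesis ip_norm : induces_norm ip.

Lemma ip_ge0 x : 0 <= ip x x.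
Proof. by rewrite -ip_norm sqr_ge0. Qed.

Lemma ip_le0 x : ip x x <= 0 -> x = 0.
Proof.
rewrite -ip_norm => x0; apply/eqP; rewrite -normr_eq0 -sqrf_eq0.
by rewrite eq_le x0 sqr_ge0.
Qed.

Lemma ip_inj x y : (forall z, ip x z = ip y z) -> x = y.
Proof.
move=> xy; apply/eqP; rewrite -subr_eq0; apply/eqP/ip_le0.
by rewrite ipDl ipNl xy subrr.
Qed.

Lemma ip_le_norm x y : `|ip x y| <= `|x| * `|y|.
Proof.
have key a b : ip a b <= `|a| * `|b|.
  have [->|a0] := eqVneq a 0; first by rewrite ip0l normr0 mul0r.
  have [->|b0] := eqVneq b 0; first by rewrite ip0r normr0 mulr0.
  have := ip_ge0 (`|b| *: a - `|a| *: b).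
  rewrite !ipE -!ip_norm (ipC b a) => H.
  have {}H : 0 <= 2 * (`|a| * `|b|) * (`|a| * `|b| - ip a b) by lra.
  by move: H; rewrite pmulr_rge0 ?subr_ge0// !mulr_gt0 ?normr_gt0.
rewrite ler_norml key andbT lerNl.
by rewrite -ipNl (le_trans (key _ _))// normrN.
Qed.

Lemma ip_continuous z : continuous (fun x => ip x z).
Proof.
move=> x; apply/cvgrPdist_le => e e0; near=> t.
have -> : ip x z - ip t z = ip (x - t) z by rewrite ipDl ipNl.
apply: le_trans (ip_le_norm _ _) _.
have z0 : 0 < `|z| + 1 by rewrite ltr_wpDl.
rewrite (@le_trans _ _ (`|x - t| * (`|z| + 1)))//.
  by rewrite ler_wpM2l// lerDl.
rewrite -ler_pdivlMr//; near: t.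
by apply: cvgr_dist_le; [exact: cvg_id|rewrite divr_gt0].
Unshelve. all: by end_near. Qed.

Lemma ip_cvg (T : Type) (F : set_system T) (FF : Filter F) (f : T -> X) l z :
  f @ F --> l -> ip (f t) z @[t --> F] --> ip l z.
Proof. by move=> fl; apply: (cvg_comp _ _ fl (@ip_continuous z l)). Qed.

End InnerProduct.

(** Strong convexity and Fejér monotonicity both bound squared distances, and
    only those between a term and the later ones. *)
Lemma cvg_sqr_dist (R : realType) (X : completeNormedModType R) (u : nat -> X)
    (e : nat -> R) :
  e @ \oo --> 0 -> (forall n m, (n <= m)%N -> `|u n - u m| ^+ 2 <= e n) ->
  cvg (u @ \oo).
Proof.
move=> e0 ue; apply: cauchy_cvg; apply: cauchy_exP => r r0.
have r20 : 0 < r ^+ 2 by rewrite exprn_gt0.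
have [N _ Ne] : \forall n \near \oo, e n < r ^+ 2.
  by move/cvgr_lt : e0; apply.
exists (u N), N => // m /= Nm.
rewrite -ball_normE /= -(@ltr_pXn2r _ 2)// ?nnegrE//; last exact: ltW.
by rewrite (le_lt_trans (ue _ _ Nm))// Ne/=.
Qed.

(** * Limits along ultrafilters and the weak topology *)

Section UltrafilterLimits.

(** If the preimage of a neighborhood [A] of [l] is not in [F], its complement
    can be added to [F], and an ultrafilter above the result does not converge
    to [l]. *)
Lemma cvg_ultra (T : Type) (Y : topologicalType) (F : set_system T) (f : T -> Y)
    (l : Y) : Filter F ->
  (forall G, UltraFilter G -> F `<=` G -> f @ G --> l) -> f @ F --> l.
Proof.
move=> FF FG A Al; apply: contrapT => /= nFA.
have FA : ~ F (f @^-1` A) by exact: nFA.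
pose H := within (~` (f @^-1` A)) F.
have HP : ProperFilter H.
  apply: Build_ProperFilter_ex => B HB; apply: contrapT => nB; apply: FA.
  have {}HB : F (fun t => (~` (f @^-1` A)) t -> B t) by exact: HB.
  apply: filterS HB => t Bt; apply: contrapT => At.
  by apply: nB; exists t; exact: Bt.
have [G [GU HG]] := ultraFilterLemma HP.
have /(FG G GU) : F `<=` G.
  by move=> B FB; apply: HG; apply: filterS FB => t Bt _.
move=> /(_ _ Al) GlA; have GA : G (f @^-1` A) by exact: GlA.
have GnA : G (~` (f @^-1` A)).
  by apply: HG; apply: (@filterS _ F _ setT) => //; exact: filterT.
have GP : ProperFilter G by exact: ultra_proper.
have G0 : G set0 by rewrite -(setICr (f @^-1` A)); exact: filterI.
exact: (@filter_not_empty _ G GP G0).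
Qed.

Lemma ultra_bounded_cvg (R : realType) (T : Type) (G : set_system T)
    (GU : UltraFilter G) (f : T -> R) (M : R) :
  (forall t, `|f t| <= M) -> exists l : R, f @ G --> l.
Proof.
move=> fM; have GP : ProperFilter G by exact: ultra_proper.
have GM : fmap f G `[- M, M]%classic.
  by apply: (@filterS _ G _ setT) filterT => t _ /=; rewrite in_itv/= -ler_norml.
have [l [_ cl]] := @segment_compact R (- M) M (fmap f G) _ GM.
exists l => A lA; have [//|GA] := in_ultra_setVsetC (f @^-1` A) GU.
have [s []] := cl (~` A) A GA lA.
by [].
Qed.

End UltrafilterLimits.

Section WeakTopology.
Context (R : realType) (X : normedModType R) (ip : {dot X for idfun}).

Lemma weak_cvgP (F : set_system X) (l : X) : Filter F ->
  F --> (l : weak_top ip) <-> forall z, ip t z @[t --> F] --> ip l z.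
Proof.
move=> FF.
have E : F --> (l : weak_top ip) <->
    {ptws, (fun x : X => (fun z => ip x z) : X -> R) @ F --> (fun z => ip l z)}.
  split=> [Fl|Fl A [_ [[B Bop <-] Bl] sBA]].
    apply: cvg_comp Fl _.
    exact: (@initial_continuous X _
      (fun x : X => (fun z => ip x z) : {ptws X -> R})).
  by apply: filterS sBA _; apply: Fl; apply: open_nbhs_nbhs.
by rewrite E; exact: pointwise_cvgP.
Qed.

End WeakTopology.

(** * Proximal points and projections *)

Definition convex_subset (R : realType) (X : normedModType R) (C : set X) :=
  forall (x y : X) (t : R), 0 < t -> t < 1 -> C x -> C y ->
    C (t *: x + (1 - t) *: y).

Lemma fin_num_eproper (R : realType) (X : normedModType R) (f : X -> \bar R) z :
  eproper f -> (f z < +oo)%E -> f z \is a fin_num.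
Proof. by move=> [fNy _] fz; rewrite fin_numElt fNy. Qed.

(** Convexity restated with real upper bounds on the values, so that the
    arithmetic takes place in [R]. *)
Lemma econvex_le (R : realType) (X : normedModType R) (f : X -> \bar R) x y
    (t a b c : R) : econvex f -> 0 < t -> t < 1 ->
  (f x <= a%:E)%E -> (f y <= b%:E)%E -> t * a + (1 - t) * b <= c ->
  (f (t *: x + (1 - t) *: y)%R <= c%:E)%E.
Proof.
move=> cf t0 t1 fa fb abc; apply: le_trans (cf x y t t0 t1) _.
have t1' : 0 < 1 - t by rewrite subr_gt0.
have c' : (t%:E * a%:E + (1 - t)%:E * b%:E <= c%:E)%E by rewrite lee_fin.
by apply: le_trans c'; rewrite leeD// lee_pmul2l.
Qed.

Lemma ler_slope0 (R : realFieldType) (a b : R) :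
  (forall t, 0 < t -> t < 1 -> a <= t * b) -> a <= 0.
Proof.
move=> H; rewrite leNgt; apply/negP => a0.
have b0 : 0 < b.
  have h : a <= 2^-1 * b by apply: H; lra.
  lra.
have c0 : 0 < a + 2 * b by lra.
have := H (a / (a + 2 * b)).
rewrite divr_gt0// ltr_pdivrMr// mul1r => /(_ isT).
rewrite ltrDl mulr_gt0// => /(_ isT).
rewrite mulrAC ler_pdivlMr//; nra.
Qed.

Section Hilbert.
Context (R : realType) (X : completeNormedModType R) (ip : {dot X for idfun}).
Hypothesis ip_norm : induces_norm ip.
Implicit Types (f g : X -> \bar R) (C U : set X).

Let sqE x y : `|x - y| ^+ 2 = ip x x - 2 * ip x y + ip y y.
Proof. by rewrite ip_norm !ipE (ipC _ y x); lra. Qed.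

Let penalty (x z : X) : R := (2^-1 : R) * (ip (x - z) (x - z) : R).

Let proxE f x :
  prox f x = xget 0 (argmin (fun z => f z + (penalty x z)%:E)%E).
Proof. by rewrite /prox; under eq_fun do rewrite ip_norm. Qed.

Let penalty_continuous x : continuous (penalty x).
Proof.
move=> z; apply: cvgM; first exact: cvg_cst.
under eq_fun do rewrite -ip_norm; rewrite -ip_norm.
apply: (cvg_comp _ (fun r : R => r ^+ 2)); last exact: exprn_continuous.
apply: cvg_norm; apply: cvgB; [exact: cvg_cst|exact: cvg_id].
Qed.

(** The parallelogram law makes the squared distance of two almost minimizers
    small, so a minimizing sequence converges; lower semicontinuity makes its
    limit a minimizer.  Projections, proximal points and the Riesz theorem are
    all instances, which is why the lower bound is assumed on the penalized
    function rather than on [f]. *)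
Lemma prox_exists f x : econvex f -> lower_semicontinuous f -> eproper f ->
  (exists c : R, forall z, (c%:E <= f z + (penalty x z)%:E)%E) ->
  argmin (fun z => f z + (penalty x z)%:E)%E !=set0.
Proof.
move=> cf lf pf [c cbound].
pose S := [set r | exists z, (f z <= (r - penalty x z)%:E)%E].
have Sc r : S r -> c <= r.
  move=> [z fz]; rewrite -lee_fin (le_trans (cbound z))//.
  by rewrite -leeBrDr// -EFinB.
have S0 : has_inf S.
  split; last by exists c => r /Sc.
  have [_ [z fz]] := pf; have fzE := fin_num_eproper pf fz.
  by exists (fine (f z) + penalty x z), z; rewrite addrK fineK.
pose m := inf S.
have mS r : S r -> m <= r by apply: ge_inf; case: S0.
have near_m n : exists z, (f z <= (m + n.+1%:R^-1 - penalty x z)%:E)%E.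
  have n0 : 0 < n.+1%:R^-1 :> R by rewrite invr_gt0 ltr0n.
  have [r [z fz] rm] := inf_adherent n0 S0.
  by exists z; rewrite (le_trans fz)// lee_fin lerD2r ltW.
clearbody m; pose zs n := projT1 (cid (near_m n)).
have zsP n : (f (zs n) <= (m + n.+1%:R^-1 - penalty x (zs n))%:E)%E.
  by rewrite /zs; case: cid.
have inv0 : n.+1%:R^-1 @[n --> \oo] --> (0 : R) by exact: cvg_harmonic.
have inv8 : (8 * n.+1%:R^-1 : R) @[n --> \oo] --> 0.
  by rewrite -(mulr0 8); apply: cvgM => //; exact: cvg_cst.
have [|p zsp] := (cvg_ex _).1 (@cvg_sqr_dist _ X zs _ inv8 _).
  move=> n k nk.
  have mid : S (m + n.+1%:R^-1 - (8^-1 : R) * `|zs n - zs k| ^+ 2).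
    (* the midpoint of the two almost minimizers *)
    pose t : R := 2^-1; have tE : t = 2^-1 by []; clearbody t.
    exists (t *: zs n + (1 - t) *: zs k).
    have kn : k.+1%:R^-1 <= n.+1%:R^-1 :> R.
      by rewrite lef_pV2 ?posrE ?ltr0n ?ler_nat.
    apply: (econvex_le cf _ _ (zsP n) (zsP k)); [lra|lra|].
    rewrite /penalty.
    have -> : x - (t *: zs n + (1 - t) *: zs k) =
      t *: (x - zs n) + (1 - t) *: (x - zs k).
      by rewrite !scalerBr addrACA -scalerDl -opprD [t + _]addrC subrK scale1r.
    have -> : zs n - zs k = (x - zs k) - (x - zs n).
      by rewrite opprB [RHS]addrC addrA subrK.
    move: (x - zs n) (x - zs k) => a b.
    rewrite sqE !ipE (ipC _ b a) tE.
    by move: (n.+1%:R^-1) (k.+1%:R^-1) (ip a a) (ip a b) (ip b b) kn => *; lra.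
  have := mS _ mid; rewrite -addrA lerDl subr_ge0 => h.
  by rewrite -ler_pdivrMl// (le_trans _ h).
exists p.
have fp : (f p <= (m - penalty x p)%:E)%E.
  rewrite leNgt; apply/negP => fp.
  have [a /andP[pa ap]] : exists a, (m - penalty x p < a) && (a%:E < f p)%E.
    have [fpy|fpy] := eqVneq (f p) +oo%E.
      by exists (m - penalty x p + 1); rewrite ltrDl ltr01 fpy ltry.
    have fpoo : (f p < +oo)%E by rewrite ltey.
    have fpE := fin_num_eproper pf fpoo.
    move: fp; rewrite -(fineK fpE) lte_fin => fp.
    exists ((m - penalty x p + fine (f p)) / 2).
    by rewrite lte_fin midf_lt// midf_lt.
  have [V pV Va] := lf _ _ ap.
  have low : \forall n \near \oo, a <= m + n.+1%:R^-1 - penalty x (zs n).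
    have Vz : \forall n \near \oo, V (zs n) by exact: (zsp V pV).
    apply: filterS Vz => n /Va /ltW fa.
    by rewrite -lee_fin; exact: le_trans fa (zsP n).
  have lim : (m + n.+1%:R^-1 - penalty x (zs n)) @[n --> \oo] -->
      m + 0 - penalty x p.
    apply: cvgB; first by apply: cvgD => //; exact: cvg_cst.
    exact: (cvg_comp _ _ zsp (@penalty_continuous x p)).
  have : a <= m + 0 - penalty x p.
    rewrite -(cvg_lim _ lim)//; apply: limr_ge => //.
    by apply/cvg_ex; eexists; exact: lim.
  by rewrite addr0 leNgt pa.
move=> z /=; have [fz|fz] := eqVneq (f z) +oo%E.
  by rewrite fz addye ?leey// -ltNye.
have fzoo : (f z < +oo)%E by rewrite ltey.
have fzE := fin_num_eproper pf fzoo.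
apply: (@le_trans _ _ m%:E); first by rewrite -leeBrDr// -EFinB.
rewrite -(fineK fzE) -EFinD lee_fin; apply: mS; exists z.
by rewrite addrK fineK.
Qed.

(** Compare [p] with the points [t *: z + (1 - t) *: p] and let [t] tend to 0. *)
Lemma argmin_subdiff f x p : econvex f -> eproper f ->
  argmin (fun z => f z + (penalty x z)%:E)%E p -> subdiff ip f p (x - p).
Proof.
move=> cf pf pmin z /=.
have fin y : (f y < +oo)%E -> f y = (fine (f y))%:E.
  by move=> fy; rewrite fineK// (fin_num_eproper pf fy).
have fpE : f p = (fine (f p))%:E.
  have [_ [y /= fy]] := pf; apply: (fin _); rewrite ltey; apply/negP => /eqP fp.
  by have := pmin y; rewrite /= fp (fin _ fy) addye// leye_eq.
have [fz|fz] := eqVneq (f z) +oo%E; first by rewrite fz leey.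
have {}fz : f z = (fine (f z))%:E by apply: (fin _); rewrite ltey.
rewrite fpE fz -EFinD lee_fin; move: fpE fz.
set r := fine (f p); set s := fine (f z) => fpE fzE.
suff : r + ip (z - p) (x - p) - s <= 0 by lra.
apply: (@ler_slope0 _ _ ((2^-1 : R) * ip (z - p) (z - p))) => t t0 t1.
have fzs : (f z <= s%:E)%E by rewrite fzE.
have fpr : (f p <= r%:E)%E by rewrite fpE.
have := pmin (t *: z + (1 - t) *: p); rewrite /= fpE.
move=> /le_trans/(_ (leeD2r _ (econvex_le cf t0 t1 fzs fpr (lexx _)))).
rewrite -!EFinD lee_fin /penalty.
have -> : x - (t *: z + (1 - t) *: p) = (x - p) - t *: (z - p).
  by rewrite scalerBl scale1r scalerBr addrCA opprD addrA.
move: (x - p) (z - p) => a b.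
rewrite ?ip_norm !ipE (ipC _ b a) => H.
rewrite -(ler_pM2l t0); lra.
Qed.

Lemma subdiff_fin f p u : eproper f -> subdiff ip f p u -> f p \is a fin_num.
Proof.
move=> pf fpu; apply: fin_num_eproper => //.
have [_ [y /= fy]] := pf; rewrite ltey; apply/negP => /eqP fp.
have := fpu y; rewrite /= fp addye// leye_eq => /eqP fy'.
by move: fy; rewrite /edom/= fy'.
Qed.

Lemma subdiff_argmin f x p : eproper f -> subdiff ip f p (x - p) ->
  argmin (fun z => f z + (penalty x z)%:E)%E p.
Proof.
move=> pf fp z /=; have fpE := subdiff_fin pf fp.
apply: le_trans (leeD2r _ (fp z)).
rewrite -(fineK fpE) -!EFinD lee_fin -addrA lerD2l /penalty.
have -> : x - z = (x - p) - (z - p) by rewrite opprB addrA subrK.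
move: (x - p) (z - p) => a b.
have := ip_ge0 ip_norm b; rewrite !ipE (ipC _ b a); lra.
Qed.

Lemma subdiff_monotone f p q u w : eproper f ->
  subdiff ip f p u -> subdiff ip f q w -> 0 <= ip (p - q) (u - w).
Proof.
move=> pf fp fq; have := fp q; have := fq p.
rewrite /= -(fineK (subdiff_fin pf fp)) -(fineK (subdiff_fin pf fq)).
by rewrite -!EFinD !lee_fin !ipE; lra.
Qed.

Lemma prox_unique f x p q : eproper f ->
  subdiff ip f p (x - p) -> subdiff ip f q (x - q) -> p = q.
Proof.
move=> pf fp fq; apply/eqP; rewrite -subr_eq0; apply/eqP/(ip_le0 ip_norm).
have := subdiff_monotone pf fp fq.
have -> : x - p - (x - q) = - (p - q) by rewrite !opprB [LHS]addrC addrA subrK.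
by rewrite ipNr oppr_ge0.
Qed.

Lemma prox_eq f x p : econvex f -> eproper f ->
  subdiff ip f p (x - p) -> prox f x = p.
Proof.
move=> cf pf fp; apply: (prox_unique pf _ fp).
by rewrite proxE; apply: argmin_subdiff => //; apply: xgetI (subdiff_argmin pf fp).
Qed.

(** Any subgradient [u] of [f] provides the affine minorant that bounds the
    penalized function from below. *)
Lemma prox_subdiff f x w u : econvex f -> lower_semicontinuous f -> eproper f ->
  subdiff ip f w u -> subdiff ip f (prox f x) (x - prox f x).
Proof.
move=> cf lf pf fw; rewrite proxE; apply: argmin_subdiff => //.
have [|p] := prox_exists (x := x) cf lf pf; last exact: xgetI.
have fwE := subdiff_fin pf fw.
(* complete the square of [x - z - u] *)
exists (fine (f w) + ip (x - w) u - (2^-1 : R) * ip u u) => z.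
apply: le_trans (leeD2r _ (fw z)).
rewrite -(fineK fwE) -!EFinD lee_fin /penalty.
have -> : z - w = (x - w) - (x - z) by rewrite opprB [RHS]addrC addrA subrK.
have := ip_ge0 ip_norm (x - z - u).
move: (x - z) (x - w) => a b.
rewrite !ipE (ipC _ u a); lra.
Qed.

Lemma projector_eq C x p : C p -> (forall q, C q -> ip (q - p) (x - p) <= 0) ->
  projector C x = p.
Proof.
move=> Cp var; rewrite /projector.
have pmin : [set p | C p /\ forall q, C q -> `|x - p| <= `|x - q|] p.
  split=> // q Cq; rewrite -(@ler_pXn2r _ 2)// ?nnegrE//.
  have -> : x - q = (x - p) - (q - p) by rewrite opprB addrA subrK.
  have := var _ Cq; have := ip_ge0 ip_norm (q - p).
  by rewrite [`|x - p - _| ^+ 2]sqE ip_norm (ipC _ (q - p)); lra.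
have := xgetI 0 pmin; set p' := xget _ _ => -[Cp' p'min].
apply/eqP; rewrite -subr_eq0; apply/eqP/(ip_le0 ip_norm).
have : `|x - p'| ^+ 2 <= `|x - p| ^+ 2 by rewrite lerXn2r ?nnegrE// p'min.
have -> : x - p' = (x - p) - (p' - p) by rewrite opprB addrA subrK.
by have := var _ Cp'; rewrite [`|x - p - _| ^+ 2]sqE ip_norm (ipC _ (p' - p)); lra.
Qed.

(** The projector is the proximal operator of the indicator function, whose
    subgradient inequality is the obtuse angle criterion. *)
Lemma projectorP C x : closed C -> convex_subset C -> C !=set0 ->
  C (projector C x) /\
  forall q, C q -> ip (q - projector C x) (x - projector C x) <= 0.
Proof.
move=> clC cvC [c0 Cc0]; pose f := eindicator C.
have fC z : C z -> f z = 0%E by move=> Cz; rewrite /f /eindicator mem_set.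
have fNC z : ~ C z -> f z = +oo%E by move=> Cz; rewrite /f /eindicator memNset.
have f0 z : (0 <= f z)%E.
  by have [/fC->//|/fNC->] := pselect (C z); rewrite leey.
have pf : eproper f.
  split; last by exists c0; rewrite /edom/= fC.
  by move=> z; exact: lt_le_trans (ltNyr 0) (f0 z).
have cf : econvex f.
  move=> a b t t0 t1; have t1' : 0 < 1 - t by rewrite subr_gt0.
  have [Ca|Ca] := pselect (C a); last first.
    by rewrite (fNC a)// gt0_muley ?lte_fin// addye ?leey//
      -ltNye (lt_le_trans (ltNyr 0))// mule_ge0// lee_fin ltW.
  have [Cb|Cb] := pselect (C b); last first.
    by rewrite (fNC b)// [X in (_ + X)%E]gt0_muley ?lte_fin// addey ?leey//
      -ltNye (lt_le_trans (ltNyr 0))// mule_ge0// lee_fin ltW.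
  by rewrite (fC a)// (fC b)// !mule0 adde0 fC//; exact: cvC.
have lf : lower_semicontinuous f.
  apply/lower_semicontinuousP => a; have [a0|a0] := ltP a 0.
    rewrite [X in open X](_ : _ = setT); first exact: openT.
    by apply/seteqP; split=> // z _ /=; rewrite (lt_le_trans _ (f0 z))// lte_fin.
  rewrite [X in open X](_ : _ = ~` C); first exact: closed_openC.
  apply/seteqP; split=> z /=; last by move=> Cz; rewrite fNC ?ltry.
  by move=> + Cz; rewrite fC// lte_fin ltNge a0.
have [|p pmin] := prox_exists (x := x) cf lf pf.
  by exists 0 => z; rewrite adde_ge0// lee_fin mulr_ge0// (ip_ge0 ip_norm).
have fp := argmin_subdiff cf pf pmin.
have Cp : C p.
  apply: contrapT => /fNC; have := subdiff_fin pf fp.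
  by move=> /[swap] ->.
have var q : C q -> ip (q - p) (x - p) <= 0.
  by move=> Cq; have := fp q; rewrite /= fC// fC// add0e lee_fin.
by rewrite (projector_eq Cp var).
Qed.

(** The representing vector is the proximal point of [- L] at the origin. *)
Lemma riesz (L : X -> R) (M : R) :
  (forall a x y, L (a *: x + y) = a * L x + L y) ->
  (forall x, `|L x| <= M * `|x|) -> exists c, forall x, L x = ip c x.
Proof.
move=> Llin LM; pose f z := (- L z)%:E.
have LD x y : L (x + y) = L x + L y by rewrite -[x]scale1r Llin scale1r mul1r.
have L0 : L 0 = 0 by have := LD 0 0; rewrite addr0; lra.
have LZ a x : L (a *: x) = a * L x by rewrite -[a *: x]addr0 Llin L0 addr0.
have LN x : L (- x) = - L x by rewrite -scaleN1r LZ mulN1r.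
have LB x y : L (x - y) = L x - L y by rewrite LD LN.
have pf : eproper f by split=> [z|]; [rewrite ltNyr|exists 0; rewrite /edom/= ltry].
have cf : econvex f.
  by move=> x y t t0 t1; rewrite /f -!EFinM -EFinD lee_fin LD !LZ; lra.
have lf : lower_semicontinuous f.
  move=> x a; rewrite lte_fin => aL.
  have M0 : 0 < `|M| + 1 by rewrite ltr_wpDl.
  exists (ball x ((- L x - a) / (`|M| + 1))).
    by apply: nbhsx_ballx; rewrite divr_gt0// subr_gt0.
  move=> y; rewrite -ball_normE/= ltr_pdivlMr// => xy; rewrite lte_fin.
  have := le_trans (ler_norm _) (LM (y - x)); rewrite LB distrC => Lyx.
  have : M * `|x - y| <= `|x - y| * (`|M| + 1).
    by rewrite mulrC ler_wpM2l// (le_trans (ler_norm M))// lerDl.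
  lra.
have [|c cmin] := prox_exists (x := 0) cf lf pf.
  (* the minimum over r of r^2 / 2 - M r *)
  exists (- ((2^-1 : R) * M ^+ 2)) => z.
  rewrite -EFinD lee_fin /penalty sub0r ipNr ipNl opprK -ip_norm.
  have := le_trans (ler_norm _) (LM z); have := sqr_ge0 (`|z| - M); nra.
have cP := argmin_subdiff cf pf cmin.
have key w : L w <= ip c w.
  have := cP (c + w); have -> : c + w - c = w by rewrite addrC addKr.
  by rewrite /= /f -EFinD lee_fin LD sub0r ipNr (ipC _ w); lra.
exists c => w; apply/eqP; rewrite eq_le key/=.
by have := key (- w); rewrite LN ipNr lerN2.
Qed.

(** Weak compactness of bounded sets: the limits of the coordinates
    [ip (p t) w] form a bounded linear functional of [w]. *)
Lemma ultra_bounded_weak_cvg (T : Type) (G : set_system T) (GU : UltraFilter G)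
    (p : T -> X) (M : R) : (forall t, `|p t| <= M) ->
  exists c, forall w, ip (p t) w @[t --> G] --> ip c w.
Proof.
move=> pM; have GP : ProperFilter G by exact: ultra_proper.
have ipM w t : `|ip (p t) w| <= M * `|w|.
  by rewrite (le_trans (ip_le_norm ip_norm _ _))// ler_wpM2r.
have ex w : exists l : R, ip (p t) w @[t --> G] --> l.
  exact: ultra_bounded_cvg (ipM w).
pose L w := projT1 (cid (ex w)).
have LP w : ip (p t) w @[t --> G] --> L w by rewrite /L; case: cid.
have [|w|c cL] := @riesz L M.
- move=> a x y.
  have lim : ip (p t) (a *: x + y) @[t --> G] --> a * L x + L y.
    under eq_fun do rewrite ipDr ipZr.
    by apply: cvgD => //; apply: cvgM => //; exact: cvg_cst.
  exact: cvg_unique (LP _) lim.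
- have Lw : `|ip (p t) w| @[t --> G] --> `|L w| by exact: cvg_norm.
  rewrite -(cvg_lim _ Lw)//.
  apply: limr_le; first by apply/cvg_ex; eexists; exact: Lw.
  exact: nearW.
- by exists c => w; rewrite -cL.
Qed.

(** A closed convex set contains its weak limits: it is cut out by the
    half-spaces that its projector defines. *)
Lemma weak_closed (T : Type) (G : set_system T) (GP : ProperFilter G)
    (p : T -> X) c C : closed C -> convex_subset C ->
  (\forall t \near G, C (p t)) -> (forall w, ip (p t) w @[t --> G] --> ip c w) ->
  C c.
Proof.
move=> clC cvC Cp pc.
have C0 : C !=set0 by have [t Ct] := filter_ex Cp; exists (p t).
have [Cq var] := projectorP c clC cvC C0.
suff -> : c = projector C c by [].
apply/eqP; rewrite -subr_eq0; apply/eqP/(ip_le0 ip_norm).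
have lim : ip (p t - projector C c) (c - projector C c) @[t --> G] -->
    ip (c - projector C c) (c - projector C c).
  rewrite ipDl; under eq_fun do rewrite ipDl.
  by apply: cvgD => //; exact: cvg_cst.
rewrite -(cvg_lim _ lim)//; apply: limr_le.
  by apply/cvg_ex; eexists; exact: lim.
by apply: filterS Cp => t; exact: var.
Qed.

End Hilbert.

(** * Projection onto a closed subspace *)

Section Subspace.
Context (R : realType) (X : completeNormedModType R) (ip : {dot X for idfun}).
Hypothesis ip_norm : induces_norm ip.
Context (U : set X).
Hypotheses (submodU : submod_closed [in U]) (closedU : closed U).

Lemma subspace0 : U 0.
Proof. by have [/set_mem] := submodU. Qed.

Lemma subspaceP a x y : U x -> U y -> U (a *: x + y).
Proof.
move=> Ux Uy; have [_ /(_ a x y)] := submodU.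
by rewrite !inE => /(_ Ux Uy).
Qed.

Lemma subspaceZ a x : U x -> U (a *: x).
Proof. by move=> Ux; rewrite -[_ *: _]addr0; apply: subspaceP subspace0. Qed.

Lemma subspaceD x y : U x -> U y -> U (x + y).
Proof. by move=> Ux; rewrite -[x]scale1r; exact: subspaceP. Qed.

Lemma subspaceB x y : U x -> U y -> U (x - y).
Proof. by move=> Ux Uy; rewrite addrC -scaleN1r; exact: subspaceP. Qed.

Lemma convex_subspace : convex_subset U.
Proof. by move=> x y t _ _ Ux Uy; apply: subspaceP => //; exact: subspaceZ. Qed.

Lemma projector_subspace x :
  U (projector U x) /\ orth ip U (x - projector U x).
Proof.
have [|Up var] := projectorP ip_norm x closedU convex_subspace.
  by exists 0; exact: subspace0.
split=> // y Uy; have := var _ (subspaceD Uy Up).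
have := var _ (subspaceB Up Uy).
rewrite addrK [_ - y]addrC addrK ipNl => h1 h2.
by apply/eqP; rewrite eq_le h2 -oppr_le0.
Qed.

Lemma projector_subspace_eq x p : U p -> orth ip U (x - p) -> projector U x = p.
Proof.
move=> Up xp; apply: (projector_eq ip_norm) => // q Uq.
by rewrite xp//; exact: subspaceB.
Qed.

Lemma projector_subspaceD x w : orth ip U w -> projector U (x + w) = projector U x.
Proof.
move=> Uw; have [Up xp] := projector_subspace x.
apply: projector_subspace_eq => // y Uy.
by rewrite addrAC ipDr xp// Uw// addr0.
Qed.

Lemma projector_subspace_dist x y :
  `|projector U x - projector U y| <= `|x - y|.
Proof.
have [Up xp] := projector_subspace x; have [Uq yq] := projector_subspace y.
move: Up xp Uq yq; move: (projector U x) (projector U y) => p q Up xp Uq yq.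
rewrite -(@ler_pXn2r _ 2)// ?nnegrE// !ip_norm.
have Upq := subspaceB Up Uq.
have := xp _ Upq; have := yq _ Upq.
have := ip_ge0 ip_norm (x - y - (p - q)).
rewrite !ipE (ipC _ y x) (ipC _ q p) (ipC _ x p) (ipC _ x q) (ipC _ y p) (ipC _ y q).
lra.
Qed.

Lemma projector_subspace_cvg (T : Type) (F : set_system T) (FF : Filter F)
    (f : T -> X) l : f @ F --> l -> projector U (f t) @[t --> F] --> projector U l.
Proof.
move=> fl; apply/cvgrPdist_le => e e0.
have : \forall t \near F, `|l - f t| <= e by move/cvgrPdist_le : fl; apply.
by apply: filterS => t; apply: le_trans; exact: projector_subspace_dist.
Qed.

End Subspace.

Lemma convex_closure (R : realType) (X : normedModType R) (C : set X) :
  convex_subset C -> convex_subset (closure C).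
Proof.
move=> cC x y t t0 t1 Cx Cy B /nbhs_ballP[e /= e0 eB].
have [x' [Cx' xx']] := Cx _ (nbhsx_ballx x e e0).
have [y' [Cy' yy']] := Cy _ (nbhsx_ballx y e e0).
exists (t *: x' + (1 - t) *: y'); split; first exact: cC.
apply: eB; move: xx' yy'; rewrite -ball_normE/= => xx' yy'.
have -> : t *: x + (1 - t) *: y - (t *: x' + (1 - t) *: y') =
    t *: (x - x') + (1 - t) *: (y - y').
  by rewrite !scalerBr opprD addrACA.
apply: le_lt_trans (ler_normD _ _) _.
rewrite !normrZ gtr0_norm// gtr0_norm ?subr_gt0//.
nra.
Qed.

(** * Normal solutions and fixed points of the Douglas-Rachford operator *)

Section DouglasRachfordOperator.
Context (R : realType) (X : completeNormedModType R) (ip : {dot X for idfun}).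
Hypothesis ip_norm : induces_norm ip.
Context (U : set X) (g : X -> \bar R).
Hypotheses (submodU : submod_closed [in U]) (closedU : closed U).
Hypotheses (convex_g : econvex g) (lsc_g : lower_semicontinuous g).
Hypothesis (proper_g : eproper g).
Context (v : X).
Let T := DR U g.
Let Z := normal_solutions ip U g v.
Let F := shifted_fix T v.
Let P := projector U.
Hypothesis Z_neq0 : Z !=set0.
Hypothesis v_sep : forall p w, U p -> edom g w -> ip v v <= ip (p - w) v.

Ltac vec := apply: (ip_inj ip_norm) => ?; rewrite !ipE; lra.

Let PU x : U (P x).
Proof. by case: (projector_subspace ip_norm submodU closedU x). Qed.

Let POrth x : orth ip U (x - P x).
Proof. by case: (projector_subspace ip_norm submodU closedU x). Qed.

(** Otherwise the inequality [v_sep] would fail at a large multiple of [p]. *)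
Lemma displacement_orth : orth ip U v.
Proof.
move=> p Up; have [_ [w gw]] := proper_g.
apply: contrapT => /eqP pv.
pose t := (ip v v + ip w v - 1) / ip p v.
have := v_sep (subspaceZ submodU t Up) gw.
by rewrite !ipE /t divfK//; lra.
Qed.

Lemma displacement_dom w : edom g w -> ip w v <= - ip v v.
Proof. by move=> /(v_sep (subspace0 submodU)); rewrite !ipE; lra. Qed.

Lemma normal_solutionsP z :
  Z z <-> exists u, [/\ U z, orth ip U u & subdiff ip g (z - v) (v - u)].
Proof.
split.
  move=> [u]; rewrite /normal_cone; case: ifPn => [/set_mem Uz|_ []] Uu [s gs usv].
  by exists u; split=> //; have -> : v - u = s by rewrite -usv addrC addKr.
move=> [u [Uz Uu gu]]; exists u; first by rewrite /normal_cone mem_set.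
by exists (v - u) => //; rewrite addrC subrK.
Qed.

Lemma prox_subdiffT x : subdiff ip g (prox g x) (x - prox g x).
Proof.
by have [z /normal_solutionsP[u [_ _]]] := Z_neq0; exact: prox_subdiff.
Qed.

(** This is the monotonicity of the subdifferential at the two proximal points,
    once the [U]-components are separated from the orthogonal ones. *)
Lemma DR_firm a b : 0 <= ip (T a - T b) ((a - T a) - (b - T b)).
Proof.
have := subdiff_monotone proper_g (prox_subdiffT (reflector U a))
  (prox_subdiffT (reflector U b)).
rewrite /T /DR /reflector -/P.
set p := P a; set q := P b; set r := prox g _; set s := prox g _.
have Upq : U (p - q) by apply: subspaceB => //; exact: PU.
have := POrth a Upq; have := POrth b Upq; rewrite -/p -/q.
rewrite !ipE (ipC _ q p) (ipC _ s r) (ipC _ a p) (ipC _ a q) (ipC _ b p).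
rewrite (ipC _ b q) (ipC _ a r) (ipC _ a s) (ipC _ b r) (ipC _ b s) (ipC _ b a).
rewrite (ipC _ p r) (ipC _ p s) (ipC _ q r) (ipC _ q s); lra.
Qed.

Lemma DR_fejer a b :
  `|T a - T b| ^+ 2 + `|(a - T a) - (b - T b)| ^+ 2 <= `|a - b| ^+ 2.
Proof.
have := DR_firm a b; move: (T a) (T b) => a' b'.
have -> : a - b = (a' - b') + (a - a' - (b - b')) by vec.
move: (a' - b') (a - a' - (b - b')) => c d.
by rewrite !ip_norm !ipE (ipC _ d c); lra.
Qed.

(** The equation [f = T (f + v)] says that the proximal point computed by [T] is
    [P f - v], and [P f - f] is the subgradient that certifies it. *)
Lemma shifted_fixP f : F f <-> subdiff ip g (P f - v) (P f - f).
Proof.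
have E : T (f + v) = f + v - P f + prox g (2 *: P f - (f + v)).
  rewrite /T /DR /reflector (projector_subspaceD ip_norm submodU closedU)//.
  exact: displacement_orth.
have rE : P f - f = 2 *: P f - (f + v) - (P f - v) by vec.
rewrite /F /shifted_fix /= E rE; split.
  move=> fE; have -> : P f - v = prox g (2 *: P f - (f + v)).
    by apply: (addrI (f + v - P f)); rewrite -fE; vec.
  exact: prox_subdiffT.
by move=> /(prox_eq ip_norm convex_g proper_g) ->; vec.
Qed.

Lemma shifted_fix_normal f : F f -> Z (P f).
Proof.
move=> /shifted_fixP gf; apply/normal_solutionsP; exists (f - P f + v); split => //.
  move=> y Uy; rewrite ipDr (POrth f Uy) add0r; exact: displacement_orth.
by have -> : v - (f - P f + v) = P f - f by vec.
Qed.

Lemma shifted_fix_nonempty : F !=set0.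
Proof.
have [z /normal_solutionsP[u [Uz Uu gz]]] := Z_neq0.
have Pf : P (z + (u - v)) = z.
  apply: (projector_subspace_eq ip_norm submodU) => // y Uy.
  by rewrite [z + _]addrC addrK ipDr ipNr Uu// displacement_orth// subrr.
exists (z + (u - v)); apply/shifted_fixP; rewrite Pf.
by have -> : z - (z + (u - v)) = v - u by vec.
Qed.

(** Adding [v] to a subgradient at [P f - v] keeps it a subgradient, since
    [ip w v] is maximal over the domain of [g] at [P f - v]. *)
Lemma shifted_fixB f : F f -> F (f - v).
Proof.
move=> /shifted_fixP gf; apply/shifted_fixP.
have -> : P (f - v) = P f.
  apply: (projector_subspaceD ip_norm submodU closedU) => y Uy.
  by rewrite ipNr displacement_orth// oppr0.
move=> w; have [gw|gw] := eqVneq (g w) +oo%E; first by rewrite gw leey.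
apply: le_trans (gf w); rewrite leeD2l// lee_fin.
have := displacement_dom (_ : edom g w); rewrite /edom/= ltey => /(_ gw).
have := displacement_orth (PU f).
by rewrite !ipE; lra.
Qed.

Lemma DR_orbit f n : F f -> iter n T f = f - n%:R *: v.
Proof.
move=> Ff; have Fn : forall m, F (f - m%:R *: v).
  elim=> [|m IH]; first by rewrite scale0r subr0.
  by rewrite -natr1 scalerDl scale1r opprD addrA; exact: shifted_fixB.
elim: n => [|n IH]; first by rewrite scale0r subr0.
rewrite iterS IH [RHS](Fn n.+1); congr T.
by rewrite -natr1 scalerDl scale1r opprD addrA subrK.
Qed.

(** The subgradient that makes [z] a normal solution is orthogonal to [U], hence
    to [c - z]. *)
Lemma normal_solution_min z c : Z z -> U c -> (g (z - v)%R <= g (c - v)%R)%E.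
Proof.
move=> /normal_solutionsP[u [Uz Uu gz]] Uc; apply: le_trans (gz (c - v)).
have -> : ip (c - v - (z - v)) (v - u) = 0.
  have -> : c - v - (z - v) = c - z by vec.
  have Ucz := subspaceB submodU Uc Uz.
  by rewrite ipDr ipNr Uu// displacement_orth// subrr.
by rewrite adde0.
Qed.

(** A subgradient orthogonal to [U] does not see displacements within [U]. *)
Lemma subdiff_exchange z c s : U z -> U c -> (g (c - v)%R <= g (z - v)%R)%E ->
  orth ip U s -> subdiff ip g (z - v) s -> subdiff ip g (c - v) s.
Proof.
move=> Uz Uc gcz Us gz w; apply: le_trans (gz w).
apply: leeD => //; rewrite lee_fin.
have -> : w - (c - v) = (w - (z - v)) - (c - z) by vec.
have cz : ip (c - z) s = 0 by apply: Us; exact: (subspaceB submodU).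
by rewrite [X in X <= _]ipDl ipNl cz subr0.
Qed.

Lemma min_normal_solution z c : Z z -> U c -> (g (c - v)%R <= g (z - v)%R)%E -> Z c.
Proof.
move=> /normal_solutionsP[u [Uz Uu gz]] Uc gcz; apply/normal_solutionsP.
exists u; split=> //; apply: subdiff_exchange gz => // y Uy.
by rewrite ipDr ipNr displacement_orth// Uu// subrr.
Qed.

(** [F] is a product: its [U]-component ranges over [Z], independently of the
    orthogonal one. *)
Lemma shifted_fix_move f z : F f -> Z z -> F (z + (f - P f)).
Proof.
move=> Ff Zz; have [u [Uz _ _]] := (normal_solutionsP z).1 Zz.
apply/shifted_fixP; have -> : P (z + (f - P f)) = z.
  apply: (projector_subspace_eq ip_norm submodU) => //.
  by rewrite [z + _]addrC addrK.
have -> : z - (z + (f - P f)) = P f - f by vec.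
have /shifted_fixP gf := Ff.
apply: subdiff_exchange gf => //; first exact: normal_solution_min.
by move=> y Uy; rewrite -opprB ipNr (POrth f Uy) oppr0.
Qed.

(** As for every firmly nonexpansive map, the fixed points form an intersection
    of half-spaces; this gives closedness and convexity at once. *)
Lemma shifted_fix_halfspaces f :
  F f <-> forall b, 0 <= ip (f - T b) (T b + v - b).
Proof.
split=> [Ff b|/(_ (f + v))].
  have := DR_firm (f + v) b; rewrite -Ff.
  by have -> : f + v - f - (b - T b) = T b + v - b by vec.
have -> : T (f + v) + v - (f + v) = - (f - T (f + v)) by vec.
rewrite ipNr oppr_ge0 => /(ip_le0 ip_norm)/eqP.
by rewrite subr_eq0 => /eqP.
Qed.

Lemma closed_shifted_fix : closed F.
Proof.
rewrite (_ : F = \bigcap_b [set f | 0 <= ip (f - T b) (T b + v - b)]); last first.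
  apply/seteqP; split=> f; first by move=> /shifted_fix_halfspaces Ff b _ /=.
  by move=> Ff; apply/shifted_fix_halfspaces => b; exact: Ff.
apply: closed_bigI => b _.
apply: (@closed_comp _ _ (fun f => ip (f - T b) (T b + v - b)) [set r | 0 <= r]).
  move=> f _; apply: ip_cvg => //.
  by apply: cvgB; [exact: cvg_id|exact: cvg_cst].
exact: closed_ge.
Qed.

Lemma convex_shifted_fix : convex_subset F.
Proof.
move=> x y t t0 t1 /shifted_fix_halfspaces Fx /shifted_fix_halfspaces Fy.
apply/shifted_fix_halfspaces => b.
have -> : t *: x + (1 - t) *: y - T b = t *: (x - T b) + (1 - t) *: (y - T b).
  by apply: (ip_inj ip_norm) => z; rewrite !ipE; ring.
rewrite ipDl !ipZl addr_ge0// mulr_ge0//; first exact: ltW.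
by rewrite subr_ge0 ltW.
Qed.

(** * Asymptotic behaviour of an orbit *)

Context (x : X).
Let t n := iter n T x.
Let s n := n%:R *: v + t n.
Let d n := t n - t n.+1.
Let p n := P (t n).
Let q n := prox g (reflector U (t n)).
Let u n := projector F (s n).

(** Apply [DR_fejer] to [t n] and to the [n]-th point [f - n%:R *: v] of the
    orbit of [f], whose displacement is exactly [v]. *)
Lemma fejer f n : F f ->
  `|s n.+1 - f| ^+ 2 + `|d n - v| ^+ 2 <= `|s n - f| ^+ 2.
Proof.
move=> Ff; have := DR_fejer (t n) (f - n%:R *: v).
have -> : T (f - n%:R *: v) = f - n.+1%:R *: v.
  by rewrite -(DR_orbit n Ff) -iterS DR_orbit.
have -> : t n - (f - n%:R *: v) = s n - f by rewrite /s; vec.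
have -> : T (t n) - (f - n.+1%:R *: v) = s n.+1 - f by rewrite /s /t iterS; vec.
have -> : t n - T (t n) - (f - n%:R *: v - (f - n.+1%:R *: v)) = d n - v.
  by rewrite /d /t iterS -natr1; apply: (ip_inj ip_norm) => z; rewrite !ipE; ring.
by [].
Qed.

Lemma fejer_le f n m : F f -> (n <= m)%N -> `|s m - f| ^+ 2 <= `|s n - f| ^+ 2.
Proof.
move=> Ff /subnK <-; elim: (m - n)%N => [//|k IH].
rewrite addSn; apply: le_trans IH; apply: le_trans (fejer _ Ff).
by rewrite lerDl sqr_ge0.
Qed.

Lemma displacement_cvg : d @ \oo --> v.
Proof.
have [f Ff] := shifted_fix_nonempty.
pose e n := `|s n - f| ^+ 2.
have e_dec : nonincreasing_seq e by move=> n m; exact: fejer_le.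
have e_cvg : cvgn e.
  apply: nonincreasing_is_cvgn => //.
  by exists 0 => _ [n _ <-]; exact: sqr_ge0.
have e0 : (e n - e n.+1) @[n --> \oo] --> 0.
  by rewrite -(subrr (limn e)); apply: cvgB => //; rewrite cvg_shiftS.
apply/cvgrPdist_le => r r0.
have r20 : 0 < r ^+ 2 by rewrite exprn_gt0.
have : \forall n \near \oo, e n - e n.+1 <= r ^+ 2 by move/cvgr_le : e0; apply.
apply: filterS => n en.
rewrite distrC -(@ler_pXn2r _ 2)// ?nnegrE//; last exact: ltW.
by apply: le_trans en; have := fejer n Ff; rewrite /e; lra.
Qed.

Lemma orbit_bounded : exists M, forall n, `|s n| <= M.
Proof.
have [f Ff] := shifted_fix_nonempty.
exists (`|s 0 - f| + `|f|) => n.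
rewrite -[s n](subrK f) (le_trans (ler_normD _ _))// lerD2r.
by rewrite -(@ler_pXn2r _ 2)// ?nnegrE//; exact: fejer_le.
Qed.

Let uP n : F (u n) /\ forall f, F f -> ip (f - u n) (s n - u n) <= 0.
Proof.
apply: (projectorP ip_norm); [exact: closed_shifted_fix|exact: convex_shifted_fix|].
exact: shifted_fix_nonempty.
Qed.

(** For a Fejér monotone sequence, the obtuse angle at [u m] bounds the squared
    distance from [u n] to [u m] by the decrease of the squared distance
    of [s] to [F]. *)
Lemma shadow_cvg : cvg (u @ \oo).
Proof.
pose e n := `|s n - u n| ^+ 2.
have key n m : (n <= m)%N -> `|u n - u m| ^+ 2 <= e n - e m.
  move=> nm; have [Fn _] := uP n; have [_ /(_ _ Fn) var] := uP m.
  have := fejer_le Fn nm; rewrite -/(e n).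
  have -> : s m - u n = (s m - u m) - (u n - u m) by vec.
  rewrite /e; move: var; move: (s m - u m) (u n - u m) => a b.
  by rewrite !ip_norm !ipE (ipC _ b a); lra.
have e_dec : nonincreasing_seq e.
  by move=> n m /key; have := sqr_ge0 `|u n - u m|; lra.
have e_cvg : cvgn e.
  apply: nonincreasing_is_cvgn => //.
  by exists 0 => _ [n _ <-]; exact: sqr_ge0.
apply: (@cvg_sqr_dist _ _ _ (fun n => e n - limn e)).
  by rewrite -(subrr (limn e)); apply: cvgB => //; exact: cvg_cst.
move=> n m /key; have := nonincreasing_cvgn_ge e_dec e_cvg m; lra.
Qed.

Lemma displacementE n : d n = p n - q n.
Proof.
by rewrite /d /p /q /P /t iterS; move: (iter n T x) => a; rewrite /T /DR; vec.
Qed.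

(** The subgradient of [g] at [q n] grows like [n%:R *: v], but its pairing with
    [z - v - q n] contains [n%:R * (ip (d n) v - ip v v)], which is nonnegative by
    [v_sep]; what remains is controlled by [d n - v]. *)
Lemma prox_value_le z n : U z ->
  (g (q n) <= g (z - v)%R + (`|d n - v| * `|z + v - s n|)%:E)%E.
Proof.
move=> Uz; have qsub : subdiff ip g (q n) (reflector U (t n) - q n).
  exact: prox_subdiffT.
have qE := subdiff_fin proper_g qsub.
suff low : - (`|d n - v| * `|z + v - s n|) <=
    ip (z - v - q n) (reflector U (t n) - q n).
  apply: le_trans (leeD2r _ (qsub (z - v))).
  by rewrite -(fineK qE) -!EFinD lee_fin; lra.
have gap : ip (d n - v) (z + v - s n) <= ip (z - v - q n) (reflector U (t n) - q n).
  have sep : ip v v <= ip (d n) v.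
    by rewrite displacementE; apply: v_sep; [exact: PU|rewrite /edom/= ltey_eq qE].
  have : 0 <= n%:R * (ip (d n) v - ip v v) by rewrite mulr_ge0// subr_ge0.
  have := ip_ge0 ip_norm (d n - v).
  have := displacement_orth Uz; have := displacement_orth (PU (t n)).
  have := POrth (t n) Uz; have := POrth (t n) (PU (t n)).
  have -> : q n = p n - d n by rewrite displacementE; vec.
  rewrite /s /reflector -/P -/(p n); move: (d n) (p n) (t n) (n%:R : R) => e a b N.
  rewrite !ipE ?(ipC _ v e) ?(ipC _ v a) ?(ipC _ v b) ?(ipC _ v z) ?(ipC _ a e).
  rewrite ?(ipC _ b e) ?(ipC _ z e) ?(ipC _ a z) ?(ipC _ b z) ?(ipC _ b a).
  lra.
apply: le_trans gap; rewrite lerNl -ipNl.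
by rewrite (le_trans (ler_norm _))// (le_trans (ip_le_norm ip_norm _ _))// normrN.
Qed.

Lemma prox_value_ge z : Z z -> exists c, forall n,
  (g (z - v)%R - (`|d n - v| * c)%:E <= g (q n))%E.
Proof.
move=> /normal_solutionsP[w [Uz Uw gz]]; exists `|v - w| => n.
apply: le_trans (gz (q n)); apply: leeD => //; rewrite lee_fin.
have -> : q n - (z - v) = (p n - z) - (d n - v) by rewrite displacementE; vec.
have Upz : U (p n - z) by apply: (subspaceB submodU) => //; exact: PU.
rewrite [X in _ <= X]ipDl ipNl ipDr ipNr Uw// displacement_orth// subrr add0r lerN2.
by rewrite (le_trans (ler_norm _))// ip_le_norm.
Qed.

Lemma prox_value_cvg z : Z z -> g (q n) @[n --> \oo] --> g (z - v).
Proof.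
move=> Zz; have [w [Uz Uw gz]] := (normal_solutionsP z).1 Zz.
have [c low] := prox_value_ge Zz; have [M sM] := orbit_bounded.
have := fineK (subdiff_fin proper_g gz); move: (fine _) => m gm.
move: low; rewrite -gm => low.
have dist0 : `|d n - v| @[n --> \oo] --> 0.
  rewrite -(@normr0 _ X) -(subrr v); apply: cvg_norm; apply: cvgB.
    exact: displacement_cvg.
  exact: cvg_cst.
apply: (@squeeze_cvge _ _ _ _ (fun n => (m - `|d n - v| * c)%:E) _
  (fun n => (m + `|d n - v| * (`|z + v| + M))%:E)).
- apply: nearW => n; rewrite EFinB low/=.
  apply: le_trans (prox_value_le n Uz) _.
  rewrite -gm -EFinD lee_fin lerD2l ler_wpM2l//.
  by rewrite (le_trans (ler_normB _ _))// lerD2l.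
- apply: cvg_EFin; first exact: nearW.
  rewrite -[X in _ --> X](subr0 m) -[X in _ --> _ - X](mul0r c).
  apply: cvgB; first exact: cvg_cst.
  by apply: cvgM => //; exact: cvg_cst.
- apply: cvg_EFin; first exact: nearW.
  rewrite -[X in _ --> X](addr0 m) -[X in _ --> _ + X](mul0r (`|z + v| + M)).
  apply: cvgD; first exact: cvg_cst.
  by apply: cvgM => //; exact: cvg_cst.
Qed.

(** Moving [u n] within [F] along [Z] shows that the variational inequality of
    [u n] restricts to the one that characterizes the projection onto [Z]. *)
Lemma projector_normal n : projector Z (p n) = P (u n).
Proof.
have [Fu var] := uP n.
apply: (projector_eq ip_norm); first exact: shifted_fix_normal.
move=> z Zz; have [_ [Uz _ _]] := (normal_solutionsP z).1 Zz.
have := var _ (shifted_fix_move Fu Zz).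
have -> : z + (u n - P (u n)) - u n = z - P (u n) by vec.
have Uzu : U (z - P (u n)) by apply: (subspaceB submodU) => //; exact: PU.
have := POrth (t n) Uzu; have := POrth (u n) Uzu; have := displacement_orth Uzu.
rewrite /s /p; move: (z - P (u n)) => w; rewrite !(ipDr, ipNr, ipZr) => ->; lra.
Qed.

(** Sublevel sets of [g] are closed and convex, hence contain the weak limits of
    [q n], which are the ones of [p n - v]. *)
Lemma weak_cluster_normal (G : set_system nat) (GP : ProperFilter G) c :
  \oo `<=` G -> (forall w, ip (p n) w @[n --> G] --> ip c w) -> Z c.
Proof.
move=> ooG pc; have [z Zz] := Z_neq0.
have [k [Uz _ gz]] := (normal_solutionsP z).1 Zz.
have mE := subdiff_fin proper_g gz.
have Uc : U c.
  apply: (weak_closed ip_norm GP closedU (convex_subspace submodU)) pc.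
  by apply: (@filterS _ G _ setT) filterT => n _; exact: PU.
apply: (min_normal_solution Zz Uc).
rewrite -(fineK mE); apply/lee_addgt0Pr => e e0; rewrite -EFinD.
pose C := [set y | g y <= (fine (g (z - v)) + e)%:E]%E.
suff : C (c - v) by [].
apply: (@weak_closed _ _ _ ip_norm _ G GP q).
- rewrite -[C]setCK; apply: open_closedC.
  rewrite (_ : ~` C = [set y | (g y > (fine (g (z - v)) + e)%:E)%E]).
    exact: (lower_semicontinuousP _).1.
  by apply/seteqP; split=> y /=; [move/negP; rewrite -ltNge|rewrite ltNge => /negP].
- move=> y y' r r0 r1 Cy Cy'; apply: (econvex_le convex_g r0 r1 Cy Cy'); lra.
- apply: ooG.
  have lt_e : nbhs (g (z - v)) [set y | y < (fine (g (z - v)%R) + e)%:E]%E.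
    apply: open_nbhs_nbhs; split; first exact: open_ereal_lt_ereal.
    by rewrite /= -{1}(fineK mE) lte_fin ltrDl.
  have qe : \forall n \near \oo, (g (q n) < (fine (g (z - v)%R) + e)%:E)%E.
    exact: (prox_value_cvg Zz lt_e).
  by apply: filterS qe => n; exact: ltW.
- move=> w; have -> : (fun n => ip (q n) w) = (fun n => ip (p n) w - ip (d n) w).
    by apply/funext => n; rewrite displacementE !ipE; lra.
  rewrite ipDl ipNl; apply: cvgB => //.
  have dv : ip (d n) w @[n --> \oo] --> ip v w 
    by apply: (ip_cvg ip_norm); exact: displacement_cvg.
  by move=> A /dv; exact: ooG.
Qed.

(** Along any ultrafilter [p] tends weakly to some [c] in [Z], so that
    [projector Z (p n)] tends weakly to [projector Z c = c] as well as in norm to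
    [P y]. *)
Lemma projector_orbit_weak_cvg : weak_to_weak_continuous ip (projector Z) ->
  weakly_cvg ip p (P (lim (u @ \oo))).
Proof.
move=> PZ; have uy := shadow_cvg; set y := lim _ in uy *.
apply: cvg_ultra => G GU ooG; have GP : ProperFilter G by exact: ultra_proper.
have [M sM] := orbit_bounded.
have pM n : `|p n| <= M.
  have -> : p n = P (s n).
    rewrite /p /P /s [_ + t n]addrC.
    rewrite (projector_subspaceD ip_norm submodU closedU)// => w Uw.
    by rewrite ipZr displacement_orth// mulr0.
  have P0 : P 0 = 0.
    apply: (projector_subspace_eq ip_norm submodU (subspace0 submodU)) => w _.
    by rewrite subr0 ip0r.
  apply: le_trans (sM n).
  have := projector_subspace_dist ip_norm submodU closedU (s n) 0.
  by rewrite -/P P0 !subr0.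
have [c pc] := ultra_bounded_weak_cvg ip_norm GU pM.
have Zc := weak_cluster_normal GP ooG pc.
suff <- : c = P y by apply/weak_cvgP.
have PZc : projector Z c = c.
  by apply: (projector_eq ip_norm) => // z _; rewrite subrr ip0r.
have pc' : p @ G --> (c : weak_top ip) by apply/weak_cvgP.
have /weak_cvgP lim1 := cvg_comp _ _ pc' (PZ c).
apply: (ip_inj ip_norm) => w.
have lim2 : ip (P (u n)) w @[n --> G] --> ip (P y) w.
  have : ip (P (u n)) w @[n --> \oo] --> ip (P y) w.
    apply: (ip_cvg ip_norm).
    exact: (projector_subspace_cvg ip_norm submodU closedU).
  by move=> h A /h; exact: ooG.
have lim3 : ip (P (u n)) w @[n --> G] --> ip c w.
  rewrite -PZc (_ : (fun n => _) = (fun n => ip (projector Z (p n)) w)).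
    exact: lim1.
  by apply/funext => n; rewrite projector_normal.
exact: cvg_unique lim3 lim2.
Qed.

End DouglasRachfordOperator.

(** This is the variational inequality of the projection of 0 onto the closure of
    [set_sub U (edom g)], which is convex because [U] and [edom g] are. *)
Lemma displacement_sep (R : realType) (X : completeNormedModType R)
    (ip : {dot X for idfun}) (U : set X) (g : X -> \bar R) (v : X) :
  induces_norm ip -> submod_closed [in U] -> econvex g -> eproper g ->
  v = projector (closure (set_sub U (edom g))) 0 ->
  forall p w, U p -> edom g w -> ip v v <= ip (p - w) v.
Proof.
move=> ip_norm submodU convex_g proper_g vE p w Up gw.
set D := set_sub U (edom g) in vE.
have cD : convex_subset D.
  move=> _ _ r r0 r1 [a Ua [b gb <-]] [a' Ua' [b' gb' <-]].
  exists (r *: a + (1 - r) *: a'); first exact: convex_subspace.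
  exists (r *: b + (1 - r) *: b').
    have := econvex_le convex_g r0 r1 (_ : g b <= (fine (g b))%:E)%E
      (_ : g b' <= (fine (g b'))%:E)%E (lexx _).
    rewrite !fineK ?lexx; try exact: fin_num_eproper.
    by move=> /(_ isT isT) h; apply: le_lt_trans h (ltry _).
  by rewrite !scalerBr opprD addrACA.
have Dpw : closure D (p - w) by apply: subset_closure; exists p => //; exists w.
have D0 : closure D !=set0 by exists (p - w).
have [_ var] := projectorP ip_norm 0 (@closed_closure _ D) (convex_closure cD) D0.
by have := var _ Dpw; rewrite -vE sub0r !ipE; lra.
Qed.

Theorem theorem5p1 (R : realType) (X : completeNormedModType R)
    (ip : {dot X for idfun}) (U : set X) (g : X -> \bar R) :
  induces_norm ip ->
  submod_closed [in U] -> closed U ->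
  econvex g -> lower_semicontinuous g -> eproper g ->
  let T := DR U g in
  let v := min_displacement T in
  let Z := normal_solutions ip U g v in
  let F := shifted_fix T v in
  let h := fun z => (eindicator U z + g (z - v)%R)%E in
  Z !=set0 ->
  weak_to_weak_continuous ip (projector Z) ->
  set_add (orth ip U) (edom (conjugate ip g)) 0 ->
  v = projector (closure (set_sub U (edom g))) 0 ->
  forall x : X,
  let u := fun n : nat => projector F (n%:R *: v + iter n T x) in
  let y := lim (u @ \oo) in
  [/\ u @ \oo --> y /\ F y,
      weakly_cvg ip (fun n => projector U (iter n T x)) (projector U y)
        /\ argmin h (projector U y),
      (forall n, iter n.+1 T x - iter n T x + projector U (iter n T x)
                 = prox g (reflector U (iter n T x)))
        /\ weakly_cvg ip (fun n => prox g (reflector U (iter n T x)))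
             (- v + projector U y)
    & g (prox g (reflector U (iter n T x))) @[n --> \oo]
        --> ereal_inf (range h)].
Proof.
move=> ip_norm submodU closedU convex_g lsc_g proper_g T v Z F h Z0 PZ _ vE x u y.
have v_sep := displacement_sep ip_norm submodU convex_g proper_g vE.
clearbody v.
have uy : u @ \oo --> y by exact: shadow_cvg.
have Fy : F y.
  apply: (closed_cvg F) uy; first exact: closed_shifted_fix.
  apply: nearW => n.
  have [] // := projectorP ip_norm (n%:R *: v + iter n T x)
    (closed_shifted_fix ip_norm submodU closedU convex_g lsc_g proper_g Z0)
    (convex_shifted_fix ip_norm submodU closedU convex_g lsc_g proper_g Z0).
  exact: shifted_fix_nonempty.
have ZPy : Z (projector U y) by exact: shifted_fix_normal.
have [UPy _] := projector_subspace ip_norm submodU closedU y.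
have hU z : U z -> h z = g (z - v).
  by move=> Uz; rewrite /h /eindicator mem_set// add0e.
have Py_min : argmin h (projector U y).
  move=> z; rewrite (hU _ UPy); have [Uz|Uz] := pselect (U z).
    by rewrite hU//; exact: (normal_solution_min ip_norm submodU proper_g v_sep ZPy).
  rewrite /h /eindicator memNset// addye ?leey//.
  by have [/(_ (z - v)) + _] := proper_g; rewrite ltNye.
have h_inf : ereal_inf (range h) = g (projector U y - v).
  rewrite -hU//; apply/eqP; rewrite eq_le; apply/andP; split.
    by apply: ereal_inf_lbound; exists (projector U y).
  by apply: le_ereal_inf_tmp => _ [z _ <-]; exact: Py_min.
have P_weak : weakly_cvg ip (fun n => projector U (iter n T x)) (projector U y).
  exact: projector_orbit_weak_cvg.
have dE n : iter n.+1 T x - iter n T x + projector U (iter n T x)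
    = prox g (reflector U (iter n T x)).
  rewrite iterS; move: (iter n T x) => a; rewrite /T /DR.
  by apply: (ip_inj ip_norm) => ?; rewrite !ipE; lra.
split; [by []|by []|split=> //|].
- apply/weak_cvgP => w.
  have /weak_cvgP/(_ w) Pw := P_weak.
  have dw : ip (iter n T x - iter n.+1 T x) w @[n --> \oo] --> ip v w.
    by apply: ip_cvg => //; exact: displacement_cvg.
  have qw : ip (prox g (reflector U (iter n T x))) w @[n --> \oo] -->
      ip (- v + projector U y) w.
    rewrite addrC ipDl ipNl (_ : (fun n => _) =
        fun n => ip (projector U (iter n T x)) w -
          ip (iter n T x - iter n.+1 T x) w); first exact: cvgB.
    by apply/funext => n; rewrite -dE !ipE; lra.
  exact: qw.
- rewrite h_inf; exact: prox_value_cvg.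
Qed.
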